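(* There exist functions $\ell,\ell'$ assigning to each triple $(K_0,K_2,B)$ a nonnegative real number, independent of all other data below, such that the following holds. Let $(x_n),(y_n)$ be the sequences generated by $$y_n:=(1-\alpha_n)x_n+\alpha_nu,\qquad x_{n+1}:=(1-\beta_n)(Uy_n+\delta_n)+\beta_ny_n$$ (the stochastic Halpern-Mann iteration with $T=\mathrm{Id}$ and $\xi_n=0$) with parameters $\alpha_n=\frac{2}{n+2}$ and $\beta_n=\beta\in(0,1)$ for all $n\in\mathbb{N}$. Assume that $K_0\in\mathbb{N}^*$ is such that $\mathbb{E}[\|x_n-u\|],\mathbb{E}[\|Uy_n-y_n\|],\mathbb{E}[\|Uu-u\|],\mathbb{E}[\|Uy_n-u\|]\le K_0$ for all $n\in\mathbb{N}$. Also, assume that $\mathbb{E}[\|\delta_n\|]\le K_2/(n+2)^2$ for all $n\in\mathbb{N}$. Lastly, let $B\ge1/(1-\beta)$. Then $$\mathbb{E}[\|Ux_n-x_n\|]\le\frac{2L}{n+2}$$ for all $n\in\mathbb{N}^*$, where $L:=\ell(K_0,K_2,B)$. If moreover there is a nonnegative random variable $Y$ with $\mathbb{E}[Y]\le K_0$ such that for all $n\in\mathbb{N}$, $\|x_n-u\|,\|Uy_n-y_n\|,\|Uu-u\|,\|Uy_n-u\|\le Y$ almost surely, then $$\mathbb{P}\left(\exists i\ge n\,(\|Ux_i-x_i\|\ge\varepsilon)\right)\le\frac1\varepsilon\,\frac{4L'}{n+2}$$ for all $n\in\mathbb{N}^*$ and $\varepsilon>0$, where $L':=\ell'(K_0,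K_2,B)$.
   Context: $\mathbb{N}=\{0,1,2,\dots\}$, $\mathbb{N}^*=\mathbb{N}\setminus\{0\}$. $(\Omega,\mathcal{F},\mathbb{P})$ is a probability space, $(X,\|\cdot\|)$ is a separable real normed space, and an $X$-valued random variable is a measurable function $\Omega\to X$. $U:X\to X$ is nonexpansive ($\|Ux-Uy\|\le\|x-y\|$ for all $x,y\in X$); $x_0$ (the starting point) and $u$ (the anchor) are arbitrary $X$-valued random variables; $(\delta_n)$ is a sequence of $X$-valued random variables; $K_2\ge0$ is a real constant. *)

(* Defs.v *)
From mathcomp Require Import all_boot all_order all_algebra.
From mathcomp Require Import all_classical all_reals all_analysis.

Set Implicit Arguments.
Unset Strict Implicit.
Unset Printing Implicit Defensive.
Import Order.TTheory GRing.Theory Num.Theory.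
Import numFieldNormedType.Exports.

Local Open Scope classical_set_scope.
Local Open Scope ring_scope.

Definition separable (T : topologicalType) : Prop :=
  exists2 D : set T, countable D & dense D.

(* A type alias of [X] whose measurable sets are the Borel sets, so that
   [{RV P >-> borel X}] is the type of [X]-valued random variables. *)
Notation borel X := (g_sigma_algebraType (@open X)).

Definition nonexpansive (R : realType) (X : normedModType R) (U : X -> X) :
    Prop :=
  forall x y : X, `|U x - U y| <= `|x - y|.

(* The stochastic Halpern-Mann iteration in its special case without second
   mapping (T = Id) and without noise in the Halpern step (xi_n = 0), i.e. the
   recursion satisfied surely, at every point of [Omega]. *)
Definition halpern_mann (R : realType) (Omega : Type) (X : normedModType R)
    (U : X -> X) (x0 u : Omega -> X) (delta : nat -> Omega -> X)
    (alpha beta : nat -> R) (x y : nat -> Omega -> X) : Prop :=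
  [/\ forall w, x 0%N w = x0 w,
      forall n w, y n w = (1 - alpha n) *: x n w + alpha n *: u w
    & forall n w, x n.+1 w =
        (1 - beta n) *: (U (y n w) + delta n w) + beta n *: y n w].

(* Main.v *)
Require Import Defs.
From mathcomp Require Import all_boot all_order all_algebra.
From mathcomp Require Import all_classical all_reals all_analysis.
From mathcomp Require Import measurable_realfun ring lra.
Import Order.TTheory GRing.Theory Num.Theory.
Import numFieldNormedType.Exports.

Local Open Scope classical_set_scope.
Local Open Scope ring_scope.

(** Write [a_n = |x_n - u|], [t_n = |x_{n+1} - x_n|], [q_n = (n+2)^2 |delta_n|]
and [r_n = |U x_n - x_n|]. The recursion holds at every point of the probability
space, hence so do the estimates between these quantities.

Since [U] is nonexpansive, [t_{n+1}] is at most [|y_{n+1} - y_n|] plus the two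
noise terms, and [y_{n+1} - y_n] is
[(n+1)/(n+3) (x_{n+1} - x_n) + 2/((n+2)(n+3)) (x_n - u)]. After multiplication
by [(n+2)(n+3)] the contraction factor disappears into the telescoping weight
[(n+1)(n+2)] ([increment_recursion]), so summation gives
[(n+1)(n+2) t_n <= 2 a_0 + 2 a_1 + 2 sum_{k<n} a_k + 3 sum_{k<=n} q_k]
([increment_bound]). Because [x_{n+1} - y_n = (1-beta)(U y_n - y_n + delta_n)],
the residual [r_n] is controlled by [t_n], [a_n] and [delta_n]
([residual_bound]).

The first rate follows by taking expectations: the right-hand side of the
increment bound then grows linearly in [n], whereas the left-hand side carries
the factor [(n+1)(n+2)].

For the second rate, replace every [a_k] by its almost sure bound [Y]. What
remains of the time index [i >= n] is a sum of [q_k / ((i+1)(i+2))] over [k <=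
i], and each of its terms is at most [q_k / ((m+1)(m+2))] with [m = max(n,k)].
These weights no longer depend on [i] and sum to at most [2/(n+2)], so the
single random variable of [residual_tail_le] dominates the residuals on a whole
window [n <= i <= n+j], with a mean that is bounded uniformly in [j]. Markov's
inequality on each window and continuity from below as [j] grows give the tail
estimate.

Expectations may only be added for measurable functions; the iterates are random
variables because in a separable space the sum of two Borel maps is Borel
([measurable_add_borel]). *)

Set Implicit Arguments.
Unset Strict Implicit.
Unset Printing Implicit Defensive.

(** * Borel maps into a separable normed space *)

Lemma separable_dense_seq (R : realType) (X : normedModType R) :
  separable X ->
  exists s : nat -> X, forall (x : X) (e : R), 0 < e -> exists n, `|x - s n| < e.
Proof.
move=> [D cD dD].
have /pcard_surjP[s ss] := cD.
exists s => x e e0.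
have [z' [/= bz Dz']] := dD (ball x e) (ex_intro _ x (ballxx x e0)) (ball_open x e).
have [n _ nz] := ss _ Dz'.
by exists n; rewrite nz; move: bz; rewrite -ball_normE.
Qed.

Lemma measurable_fun_borel d (T : measurableType d) (X : ptopologicalType)
    (f : T -> borel X) :
  (forall A : set X, open A -> measurable (f @^-1` A)) -> measurable_fun setT f.
Proof.
move=> fo; apply (@measurability _ _ T (borel X) setT f (@open X)) => //.
by move=> _ [A oA <-]; rewrite setTI; exact: fo.
Qed.

Lemma measurable_norm_borel (R : realType) (X : normedModType R) :
  measurable_fun [set: borel X] (fun x : borel X => `|x : X|).
Proof.
apply: (measurability _ (RGenOInfty.measurableE R)) => //.
move=> _ [_ [a ->] <-]; rewrite setTI; apply: sub_sigma_algebra.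
by apply: open_comp; [move=> x _; exact: norm_continuous|exact: interval_open].
Qed.

Lemma continuous_measurable_borel (R : realType) (X Z : normedModType R) (f : X -> Z) :
  continuous f -> measurable_fun [set: borel X] (f : borel X -> borel Z).
Proof.
move=> cf; apply: measurable_fun_borel => A oA; apply: sub_sigma_algebra.
by apply: open_comp => // x _; exact: cf.
Qed.

(** Continuity of addition does not suffice, because the product of the Borel
sigma-algebras may miss open sets of [X * X]. In a separable space the preimage of
an open set is a countable union of sets [{f in ball} /\ {g in ball}], with balls
of radius [1/(k+1)] centred on a dense sequence. *)
Lemma measurable_add_borel d (T : measurableType d) (R : realType)
    (X : normedModType R) (f g : T -> borel X) :
  separable X -> measurable_fun setT f -> measurable_fun setT g ->
  measurable_fun setT (fun w => ((f w : X) + g w) : borel X).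
Proof.
move=> /separable_dense_seq[s sd] mf mg.
apply: measurable_fun_borel => A oA.
pose rad (k : nat) : R := k.+1%:R^-1.
pose F (i : nat * nat * nat) : set T :=
  if `[< ball (s i.1.1 + s i.1.2) (rad i.2 + rad i.2) `<=` A >] then
    f @^-1` (ball (s i.1.1) (rad i.2)) `&` g @^-1` (ball (s i.1.2) (rad i.2))
  else set0.
have rad0 k : 0 < rad k by rewrite invr_gt0.
rewrite [X in measurable X](_ : _ = \bigcup_i F i); last first.
  apply/seteqP; split => [w /= Aw|w [[[i j] k] _]].
    have := oA; rewrite openE => /(_ _ Aw) /nbhs_ballP[e /= e0 eA].
    (* Each of f w and g w is within e/4 of its centre and the ball around the sum
       of the centres has radius at most e/2, so that ball stays within e of
       f w + g w. *)
    have [k /= ke] : exists k, rad k < e / 4.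
      have e4 : 0 < e / 4 by rewrite divr_gt0.
      have [k _ ke] := near_infty_natSinv_lt (PosNum e4).
      by exists k; exact: (ke k (leqnn k)).
    have [i fi] := sd (f w) _ (rad0 k).
    have [j gj] := sd (g w) _ (rad0 k).
    exists (i, j, k) => //; rewrite /F /=; case: asboolP => [_|].
      by split; rewrite -ball_normE /= distrC.
    case=> z bz; apply: eA; move: bz; rewrite -!ball_normE /= => bz.
    rewrite (_ : f w + g w - z = (f w - s i) + (g w - s j) + (s i + s j - z)).
      apply: (le_lt_trans (ler_normD _ _)).
      have := ler_normD (f w - s i : X) (g w - s j : X); lra.
    by rewrite [X in _ = X + _]addrACA -opprD subrKA.
  rewrite /F /=; case: asboolP => // sA [fi gj]; apply: sA.
  move: fi gj; rewrite -!ball_normE /= => fi gj.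
  rewrite (_ : s i + s j - _ = (s i - f w) + (s j - g w)); last first.
    by rewrite addrACA -opprD.
  apply: (le_lt_trans (ler_normD _ _)); lra.
apply: countable_bigcupT_measurable => // i; rewrite /F; case: asboolP => // _.
apply: measurableI; rewrite -[X in measurable X]setTI.
  apply: mf => //; apply: sub_sigma_algebra; exact: ball_open.
apply: mg => //; apply: sub_sigma_algebra; exact: ball_open.
Qed.

Lemma nonexpansive_continuous (R : realType) (X : normedModType R) (U : X -> X) :
  nonexpansive U -> continuous U.
Proof.
move=> neU z; apply/cvgrPdist_lt => eps eps0.
apply/nbhs_ballP; exists eps => // t; rewrite -ball_normE /= => zt.
exact: le_lt_trans (neU z t) zt.
Qed.

Section borel_operations.
Context d (T : measurableType d) (R : realType) (X : normedModType R).

Lemma measurable_scale_borel (c : R) (f : T -> borel X) :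
  measurable_fun setT f -> measurable_fun setT (fun w => c *: (f w : X) : borel X).
Proof.
move=> mf.
apply: (measurableT_comp (f := fun z : borel X => (c *: (z : X) : borel X))) mf.
by apply: continuous_measurable_borel; exact: scaler_continuous.
Qed.

Lemma measurable_normB_borel (f g : T -> borel X) :
  separable X -> measurable_fun setT f -> measurable_fun setT g ->
  measurable_fun setT (fun w => `|(f w : X) - g w|).
Proof.
move=> sepX mf mg.
have mfg : measurable_fun setT (fun w => (f w : X) + (-1) *: (g w : X) : borel X).
  by apply: measurable_add_borel => //; exact: measurable_scale_borel.
under eq_fun do rewrite -scaleN1r.
exact: measurableT_comp (@measurable_norm_borel R X) mfg.
Qed.

Lemma measurable_nonexpansive (U : X -> X) (f : T -> borel X) :
  nonexpansive U -> measurable_fun setT f ->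
  measurable_fun setT (fun w => U (f w) : borel X).
Proof.
move=> neU mf; apply: (measurableT_comp (f := U : borel X -> borel X)) mf.
by apply: continuous_measurable_borel; exact: nonexpansive_continuous neU.
Qed.

End borel_operations.

(** * Nonnegative random variables with bounded mean *)

Section mean_bound.
Context d (T : measurableType d) (R : realType) (P : probability T R).
Implicit Types (f g : T -> R) (a b c eps : R).

(** Measurability and nonnegativity are bundled with the bound because additivity
of the integral needs them; the closure lemmas below then bound the mean of a
compound expression by following its syntax. *)
Definition mean_le f c : Prop :=
  [/\ measurable_fun setT f, forall w, 0 <= f w & ('E_P[f] <= c%:E)%E].

Lemma mean_leD f g a b :
  mean_le f a -> mean_le g b -> mean_le (fun w => f w + g w) (a + b).
Proof.
move=> [mf f0 fa] [mg g0 gb]; split; first exact: measurable_funD.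
  by move=> w; rewrite addr_ge0.
move: fa gb; rewrite unlock => fa gb.
under eq_integral do rewrite EFinD.
rewrite ge0_integralD//; first by rewrite EFinD leeD.
- by move=> w _; rewrite lee_fin.
- exact/measurable_EFinP.
- by move=> w _; rewrite lee_fin.
- exact/measurable_EFinP.
Qed.

Lemma mean_leZ (k : R) f c :
  0 <= k -> mean_le f c -> mean_le (fun w => k * f w) (k * c).
Proof.
move=> k0 [mf f0 fc]; split; first exact: measurable_funM.
  by move=> w; rewrite mulr_ge0.
move: fc; rewrite unlock => fc.
under eq_integral do rewrite EFinM.
rewrite ge0_integralZl_EFin//; first by rewrite EFinM lee_wpmul2l.
- by move=> w _; rewrite lee_fin.
- exact/measurable_EFinP.
Qed.

Lemma mean_le_sum (F : nat -> T -> R) (C : nat -> R) n :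
  (forall k, mean_le (F k) (C k)) ->
  mean_le (fun w => \sum_(k < n) F k w) (\sum_(k < n) C k).
Proof.
move=> FC; elim: n => [|n IH].
  under eq_fun do rewrite big_ord0; rewrite big_ord0; split => //.
  by rewrite expectation_cst.
under eq_fun do rewrite big_ord_recr; rewrite big_ord_recr /=.
exact: mean_leD.
Qed.

Lemma mean_le_weaken f a b : a <= b -> mean_le f a -> mean_le f b.
Proof.
by move=> ab [mf f0 fa]; split => //; apply: le_trans fa _; rewrite lee_fin.
Qed.

Lemma mean_le_expectation f g c :
  measurable_fun setT f -> (forall w, 0 <= f w <= g w) -> mean_le g c ->
  ('E_P[f] <= c%:E)%E.
Proof.
move=> mf fg [mg g0]; apply: le_trans; rewrite unlock.
apply: ge0_le_integral => //.
- by move=> w _; rewrite lee_fin; case/andP: (fg w).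
- exact/measurable_EFinP.
- exact/measurable_EFinP.
- by move=> w _; rewrite lee_fin; case/andP: (fg w).
Qed.

Lemma mean_le_markov (A : set T) f c eps :
  mean_le f c -> 0 < eps -> measurable A ->
  {ae P, forall w, A w -> eps <= f w} -> (P A <= (1 / eps * c)%:E)%E.
Proof.
move=> [mf f0 fc] eps0 mA Af.
have : (eps%:E * P A <= c%:E)%E.
  apply: le_trans fc; rewrite unlock.
  rewrite -[A in P A]setIT -integral_indic// -ge0_integralZl_EFin//; last 2 first.
  - by apply/measurable_EFinP; exact: measurable_indic.
  - exact: ltW.
  apply: ae_ge0_le_integral => //.
  - by move=> w _; rewrite -EFinM lee_fin mulr_ge0// ltW.
  - apply: measurable_funeM; apply/measurable_EFinP.
    exact: measurable_indic.
  - by move=> w _; rewrite lee_fin.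
  - exact/measurable_EFinP.
  apply: filterS Af => w Af _; rewrite -EFinM lee_fin indicE.
  have [wA|_] := boolP (w \in A); last by rewrite mulr0.
  by rewrite mulr1; apply: Af; rewrite inE in wA.
rewrite -(fineK (fin_num_measure P A mA)) -EFinM !lee_fin => h.
by rewrite div1r ler_pdivlMl.
Qed.

(** The dominating variable may depend on [j], as only its mean has to be bounded
uniformly: the bounds pass to the union by continuity from below. *)
Lemma mean_le_markov_bigcup (A : nat -> set T) (f : nat -> T -> R) c eps :
  (forall j, mean_le (f j) c) -> 0 < eps -> (forall j, measurable (A j)) ->
  nondecreasing_seq A ->
  {ae P, forall w, forall j, A j w -> eps <= f j w} ->
  (P (\bigcup_j A j) <= (1 / eps * c)%:E)%E.
Proof.
move=> fc eps0 mA ndA Af.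
have cvgA := @nondecreasing_cvg_mu _ _ _ P _ mA (bigcupT_measurable _ mA) ndA.
rewrite -(cvg_lim _ cvgA)//; apply: lime_le.
  by apply/cvg_ex; eexists; exact: cvgA.
apply: nearW => j; apply: mean_le_markov (fc j) eps0 (mA j) _.
by apply: filterS Af => w; apply.
Qed.

End mean_bound.

(** * Pointwise estimates along the iteration *)

Section pointwise.
Context (R : realType) (X : normedModType R) (U : X -> X).
Context (x y e : nat -> X) (u : X) (beta : R).
Context (neU : nonexpansive U).
Context (beta01 : 0 < beta < 1).
Context (yE : forall n, y n = (1 - 2 / (n%:R + 2)) *: x n + (2 / (n%:R + 2)) *: u).
Context (xE : forall n, x n.+1 = (1 - beta) *: (U (y n) + e n) + beta *: y n).

Let q k := (k%:R + 2) ^+ 2 * `|e k|.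

(** For [alpha_n = 2/(n+2)] one has [1 - alpha_{n+1} = (n+1)/(n+3)] and
[alpha_n - alpha_{n+1} = 2/((n+2)(n+3))], so the weight [(n+2)(n+3)] turns the
contraction of the increments into a telescoping sum and leaves a source term
of bounded size. The noise enters through [x_{n+1}] and through [x_{n+2}], which
costs [q n] the factor 2, an upper bound of [(n+3)/(n+2)]. *)
Lemma increment_recursion n :
  (n%:R + 2) * (n%:R + 3) * `|x n.+2 - x n.+1| <=
  (n%:R + 1) * (n%:R + 2) * `|x n.+1 - x n| + 2 * `|x n - u| + (2 * q n + q n.+1).
Proof.
have [b0 b1] := andP beta01.
have n0 : 0 <= n%:R :> R by [].
set N : R := n%:R in n0 *.
have n1E : n.+1%:R = N + 1 :> R by rewrite -natr1.
have yd : `|y n.+1 - y n| <=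
    (N + 1) / (N + 3) * `|x n.+1 - x n| + 2 / ((N + 2) * (N + 3)) * `|x n - u|.
  have -> : y n.+1 - y n = ((N + 1) / (N + 3)) *: (x n.+1 - x n) +
      (2 / ((N + 2) * (N + 3))) *: (x n - u).
    rewrite !yE n1E -/N.
    have -> : 1 - 2 / (N + 1 + 2) = (N + 1) / (N + 3) by field; lra.
    have -> : 2 / (N + 1 + 2) = 2 / (N + 2) - 2 / ((N + 2) * (N + 3)).
      by field; lra.
    have -> : 1 - 2 / (N + 2) = (N + 1) / (N + 3) - 2 / ((N + 2) * (N + 3)).
      by field; lra.
    rewrite !scalerBl !scalerBr.
    set p1 := _ *: x n.+1; set p2 := _ *: x n; set p3 := _ *: x n.
    set p4 := _ *: u; set p5 := _ *: u.
    rewrite [p4 - p5]addrC addrA [p2 - p3 + p4]addrC addrKA opprB.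
    by rewrite [p3 - p2]addrC addrACA [- p5 + p3]addrC.
  have c1 : 0 <= (N + 1) / (N + 3) by rewrite divr_ge0//; lra.
  have c2 : 0 <= 2 / ((N + 2) * (N + 3)) by rewrite divr_ge0//; nra.
  apply: (le_trans (ler_normD _ _)).
  by rewrite normrZ [X in _ + X <= _]normrZ (ger0_norm c1) (ger0_norm c2).
have xd : `|x n.+2 - x n.+1| <= `|y n.+1 - y n| + (`|e n| + `|e n.+1|).
  have -> : x n.+2 - x n.+1 =
      (1 - beta) *: ((U (y n.+1) - U (y n)) + (e n.+1 - e n))
      + beta *: (y n.+1 - y n).
    rewrite !xE opprD addrACA -!scalerBr; congr (_ *: _ + _).
    by rewrite opprD addrACA.
  apply: (le_trans (ler_normD _ _)); rewrite !normrZ (ger0_norm (ltW b0)).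
  rewrite ger0_norm; last by lra.
  have h1 := ler_normD (U (y n.+1) - U (y n)) (e n.+1 - e n).
  have h2 := ler_normB (e n.+1) (e n).
  have h3 := neU (y n.+1) (y n).
  have h4 := normr_ge0 (e n); have h5 := normr_ge0 (e n.+1).
  set r := `|U (y n.+1) - U (y n) + _| in h1 *.
  have : (1 - beta) * r <= (1 - beta) * (`|y n.+1 - y n| + (`|e n| + `|e n.+1|)).
    by apply: ler_wpM2l; lra.
  have : 0 <= beta * (`|e n| + `|e n.+1|) by rewrite mulr_ge0//; lra.
  lra.
rewrite /q n1E -/N.
have h4 := normr_ge0 (e n); have h5 := normr_ge0 (e n.+1).
apply: (@le_trans _ _ ((N + 2) * (N + 3) * ((N + 1) / (N + 3) * `|x n.+1 - x n|
    + 2 / ((N + 2) * (N + 3)) * `|x n - u| + (`|e n| + `|e n.+1|)))).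
  apply: ler_wpM2l; first by rewrite mulr_ge0//; lra.
  by apply: (le_trans xd); rewrite lerD2r.
have -> : (N + 2) * (N + 3) * ((N + 1) / (N + 3) * `|x n.+1 - x n|
      + 2 / ((N + 2) * (N + 3)) * `|x n - u| + (`|e n| + `|e n.+1|))
    = (N + 1) * (N + 2) * `|x n.+1 - x n| + 2 * `|x n - u|
      + (N + 2) * (N + 3) * (`|e n| + `|e n.+1|).
  by field; lra.
rewrite lerD2l mulrDr mulrA; apply: lerD; apply: ler_wpM2r => //; nra.
Qed.

Lemma increment_bound n :
  (n%:R + 1) * (n%:R + 2) * `|x n.+1 - x n| <=
  2 * `|x 0%N - u| + 2 * `|x 1%N - u| + 2 * (\sum_(k < n) `|x k - u|)
  + 3 * \sum_(k < n.+1) q k.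
Proof.
have q0 k : 0 <= q k by rewrite mulr_ge0// sqr_ge0.
(* Of the final coefficient 3 of q n, one unit is spent on the step that ends
   with q n and two on the next step; the induction keeps those two in reserve. *)
suff : (n%:R + 1) * (n%:R + 2) * `|x n.+1 - x n| + 2 * q n <=
  2 * `|x 0%N - u| + 2 * `|x 1%N - u| + 2 * (\sum_(k < n) `|x k - u|)
  + 3 * \sum_(k < n.+1) q k by have := q0 n; lra.
elim: n => [|n IH].
  rewrite big_ord0 big_ord1 /=.
  have h1 : `|x 1%N - x 0%N| <= `|x 1%N - u| + `|x 0%N - u|.
    by rewrite (distrC (x 0%N)); exact: ler_distD.
  have := q0 0%N; lra.
rewrite big_ord_recr [\sum_(k < n.+2) _]big_ord_recr /=.
have := increment_recursion n; have := q0 n; have := q0 n.+1.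
rewrite -[n.+1%:R]natr1; lra.
Qed.

(** The Mann step moves [y n] towards [U (y n)] by a fixed proportion, that is,
[x_{n+1} - y_n = (1-beta)(U y_n - y_n + delta_n)]; a small increment therefore
forces a small residual at [y n], at the cost of the factor [B]. The passage
from [y n] to [x n] costs twice their distance [alpha_n |x_n - u|]. *)
Lemma residual_bound B n : 1 / (1 - beta) <= B ->
  `|U (x n) - x n| <=
    (2 + B) * (2 / (n%:R + 2)) * `|x n - u|
    + B / ((n%:R + 1) * (n%:R + 2)) *
      (2 * `|x 0%N - u| + 2 * `|x 1%N - u| + 2 * (\sum_(k < n) `|x k - u|)
       + 3 * \sum_(k < n.+1) q k)
    + ((n%:R + 2) ^+ 2)^-1 * q n.
Proof.
have [b0 b1] := andP beta01; move=> Bge.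
have B0 : 0 <= B by apply: le_trans Bge; rewrite divr_ge0//; lra.
have n0 : 0 <= n%:R :> R by [].
set S := (X in _ <= _ + _ * X + _).
have hS : (n%:R + 1) * (n%:R + 2) * `|x n.+1 - x n| <= S := increment_bound n.
move: S hS => S hS.
set N : R := n%:R in n0 hS *.
have ht : `|x n.+1 - x n| <= S / ((N + 1) * (N + 2)).
  by rewrite ler_pdivlMr 1?mulrC//; nra.
have xy : `|x n - y n| = 2 / (N + 2) * `|x n - u|.
  have -> : x n - y n = (2 / (N + 2)) *: (x n - u).
    rewrite yE -/N scalerBl scale1r scalerBr; set p := _ *: x n; set p' := _ *: u.
    by rewrite opprD opprB addrA addrCA subrr addr0.
  by rewrite normrZ ger0_norm// divr_ge0//; lra.
have ey : `|U (y n) - y n| <= B * (`|x n.+1 - x n| + `|x n - y n|) + `|e n|.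
  have -> : U (y n) - y n = (1 - beta)^-1 *: (x n.+1 - y n) - e n.
    rewrite xE.
    have -> : (1 - beta) *: (U (y n) + e n) + beta *: y n - y n =
      (1 - beta) *: (U (y n) + e n - y n).
      by rewrite -addrA scalerBr; congr (_ + _); rewrite scalerBl scale1r opprB.
    rewrite scalerA mulVf ?scale1r; last by lra.
    by rewrite addrAC addrK.
  apply: (le_trans (ler_normB _ _)); rewrite lerD2r normrZ.
  rewrite ger0_norm; last by rewrite invr_ge0; lra.
  by apply: ler_pM => //; [rewrite invr_ge0; lra|rewrite -div1r|exact: ler_distD].
have rn : `|U (x n) - x n| <= 2 * `|x n - y n| + `|U (y n) - y n|.
  have h1 := ler_distD (U (y n)) (U (x n)) (x n).
  have h2 := ler_distD (y n) (U (y n)) (x n).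
  have := neU (x n) (y n); rewrite (distrC (y n)) in h2; lra.
have -> : ((N + 2) ^+ 2)^-1 * q n = `|e n|.
  by rewrite /q -/N mulrA mulVf ?mul1r// expf_neq0//; lra.
have : B * `|x n.+1 - x n| <= B / ((N + 1) * (N + 2)) * S.
  by rewrite -mulrA [_^-1 * _]mulrC; exact: ler_wpM2l.
rewrite -[(2 + B) * _ * _]mulrA -xy; lra.
Qed.

End pointwise.

(** * Weights of the noise in the tail estimate *)

(** An upper bound for [1/((i+1)(i+2))] that holds for all [i >= n] at which the [k]-th
noise term is present, that is, for all [i >= max(n,k)]. *)
Definition tail_weight (R : realType) (n k : nat) : R :=
  (((maxn n k)%:R + 1) * ((maxn n k)%:R + 2))^-1.

Lemma tail_weight_ge0 (R : realType) n k : 0 <= tail_weight R n k.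
Proof. by rewrite invr_ge0 mulr_ge0// addr_ge0. Qed.

Lemma tail_weight_ge (R : realType) n k i : (n <= i)%N -> (k <= i)%N ->
  ((i%:R + 1) * (i%:R + 2))^-1 <= tail_weight R n k.
Proof.
move=> ni ki.
have mi : ((maxn n k)%:R : R) <= i%:R by rewrite ler_nat geq_max ni.
have m0 : 0 <= (maxn n k)%:R :> R by [].
rewrite /tail_weight lef_pV2 ?posrE; try by rewrite mulr_gt0//; lra.
by apply: ler_pM; lra.
Qed.

(** The first [n+1] weights are all equal and contribute [1/(n+2)]; the later ones
telescope, since [1/((k+1)(k+2)) = 1/(k+1) - 1/(k+2)]. *)
Lemma tail_weight_sum (R : realType) n j :
  \sum_(k < n.+1 + j) tail_weight R n k = 2 / (n%:R + 2) - 1 / (n%:R + j%:R + 2).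
Proof.
have n0 : 0 <= n%:R :> R by [].
elim: j => [|j IH].
  rewrite addn0 (eq_bigr (fun=> ((n%:R + 1) * (n%:R + 2))^-1)) => [|[k kn] _ /=].
    rewrite sumr_const card_ord -mulr_natr -natr1 addr0; field; lra.
  by rewrite /tail_weight (maxn_idPl _)// -ltnS.
have j0 : 0 <= j%:R :> R by [].
rewrite addnS big_ord_recr /= IH /tail_weight (maxn_idPr _); last first.
  by rewrite addSn ltnW// ltnS leq_addr.
by rewrite addSn -[j.+1%:R]natr1 -[(n + j).+1%:R]natr1 natrD; field; lra.
Qed.

(** * The two rates *)

Section iteration.
Context (R : realType) d (Omega : measurableType d) (P : probability Omega R).
Context (X : normedModType R) (U : X -> X) (x0 u : {RV P >-> borel X}).
Context (delta : nat -> {RV P >-> borel X}) (beta : R) (x y : nat -> Omega -> X).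
Context (sepX : separable X).
Context (neU : nonexpansive U).

Lemma halpern_mann_measurable (alpha beta_ : nat -> R) n :
  halpern_mann U x0 u (fun n => delta n : Omega -> X) alpha beta_ x y ->
  measurable_fun setT (x n : Omega -> borel X).
Proof.
move=> [xx0 yE xE]; elim: n => [|n IH].
  rewrite (_ : x 0%N = (x0 : Omega -> X)); last exact/funext.
  exact: measurable_funPT.
have my : measurable_fun setT (y n : Omega -> borel X).
  rewrite (_ : y n = fun w => (1 - alpha n) *: x n w + alpha n *: u w);
    last exact/funext.
  by apply: measurable_add_borel => //; exact: measurable_scale_borel.
rewrite (_ : x n.+1 =
    fun w => (1 - beta_ n) *: (U (y n w) + delta n w) + beta_ n *: y n w).
  apply: measurable_add_borel => //; apply: measurable_scale_borel => //.
  by apply: measurable_add_borel => //; exact: measurable_nonexpansive.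
exact/funext.
Qed.

Context (K0 K2 B : R).
Context (beta01 : 0 < beta < 1).
Context (hm : halpern_mann U x0 u (fun n => delta n : Omega -> X)
  (fun n => 2 / (n%:R + 2)) (fun _ => beta) x y).
Context (K2_ge0 : 0 <= K2) (B_ge : 1 / (1 - beta) <= B) (K0_ge0 : 0 <= K0).
Context (mean_delta : forall n,
  ('E_P[fun w => (`|(delta n w : X)|)%R] <= (K2 / (n%:R + 2) ^+ 2)%:E)%E).

Let B_ge0 : 0 <= B.
Proof.
by have /andP[? ?] := beta01; apply: le_trans B_ge; rewrite divr_ge0//; lra.
Qed.

Let dist n w : R := `|x n w - (u w : X)|.
Let noise n w : R := (n%:R + 2) ^+ 2 * `|(delta n w : X)|.
Let residual n w : R := `|U (x n w) - x n w|.

Let noise_ge0 n w : 0 <= noise n w.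
Proof. by rewrite mulr_ge0// sqr_ge0. Qed.

Let mean_noise n : mean_le P (noise n) K2.
Proof.
have n2 : (n%:R + 2) ^+ 2 != 0 :> R.
  by rewrite expf_neq0// lt0r_neq0// ltr_wpDl.
rewrite -(mulfVK n2 K2) mulrC.
apply: mean_leZ; first exact: sqr_ge0.
split => //.
exact: measurableT_comp (@measurable_norm_borel R X) (measurable_funPT (delta n)).
Qed.

Let measurable_residual n : measurable_fun setT (residual n).
Proof.
have mx := halpern_mann_measurable n hm.
by apply: measurable_normB_borel => //; exact: measurable_nonexpansive.
Qed.

Let residual_le n w : residual n w <=
    (2 + B) * (2 / (n%:R + 2)) * dist n w
    + B / ((n%:R + 1) * (n%:R + 2)) *
      (2 * dist 0%N w + 2 * dist 1%N w + 2 * (\sum_(k < n) dist k w)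
       + 3 * \sum_(k < n.+1) noise k w)
    + ((n%:R + 2) ^+ 2)^-1 * noise n w.
Proof.
have [_ yE xE] := hm.
exact: (@residual_bound R X U (x^~ w) (y^~ w) (fun k => delta k w) (u w) beta).
Qed.

Lemma mean_residual_le n :
  (forall k, ('E_P[dist k] <= K0%:E)%E) ->
  ('E_P[residual n] <=
    ((4 * K0 + B * (6 * K0 + 3 * K2) + K2) / (n%:R + 2))%:E)%E.
Proof.
move=> hdist.
have md k : mean_le P (dist k) K0.
  split; [|by move=> w; exact: normr_ge0|exact: hdist].
  exact: measurable_normB_borel (halpern_mann_measurable k hm) (measurable_funPT u).
have n0 : 0 <= n%:R :> R by [].
have B0 : 0 <= B := B_ge0.
have sum_dist : mean_le P (fun w => \sum_(k < n) dist k w) (n%:R * K0).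
  by have := mean_le_sum n md; rewrite sumr_const card_ord -(mulr_natl K0).
have sum_noise : mean_le P (fun w => \sum_(k < n.+1) noise k w) ((n%:R + 1) * K2).
  have := mean_le_sum n.+1 mean_noise.
  by rewrite sumr_const card_ord -(mulr_natl K2) -[n.+1%:R]natr1.
have h : mean_le P (fun w =>
    (2 + B) * (2 / (n%:R + 2)) * dist n w
    + B / ((n%:R + 1) * (n%:R + 2)) *
      (2 * dist 0%N w + 2 * dist 1%N w + 2 * (\sum_(k < n) dist k w)
       + 3 * \sum_(k < n.+1) noise k w)
    + ((n%:R + 2) ^+ 2)^-1 * noise n w)
    ((2 + B) * (2 / (n%:R + 2)) * K0
    + B / ((n%:R + 1) * (n%:R + 2)) *
      (2 * K0 + 2 * K0 + 2 * (n%:R * K0) + 3 * ((n%:R + 1) * K2))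
    + ((n%:R + 2) ^+ 2)^-1 * K2).
  apply: mean_leD; last by apply: mean_leZ => //; rewrite invr_ge0 sqr_ge0.
  apply: mean_leD.
    by apply: mean_leZ (md n); rewrite mulr_ge0 ?divr_ge0//; lra.
  apply: mean_leZ; first by rewrite divr_ge0// mulr_ge0//; lra.
  apply: mean_leD; last by exact: mean_leZ.
  apply: mean_leD; last by exact: mean_leZ.
  by apply: mean_leD; apply: mean_leZ.
apply: (mean_le_expectation (measurable_residual n) _ (mean_le_weaken _ h)).
  by move=> w; apply/andP; split; [exact: normr_ge0|exact: residual_le].
set N : R := n%:R in n0 *.
rewrite -subr_ge0.
have -> : (4 * K0 + B * (6 * K0 + 3 * K2) + K2) / (N + 2) -
  ((2 + B) * (2 / (N + 2)) * K0 + B / ((N + 1) * (N + 2)) *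
    (2 * K0 + 2 * K0 + 2 * (N * K0) + 3 * ((N + 1) * K2)) + ((N + 2) ^+ 2)^-1 * K2)
  = 2 * (B * K0 * N) / ((N + 1) * (N + 2)) + K2 * (N + 1) / (N + 2) ^+ 2.
  by field; lra.
by rewrite addr_ge0// divr_ge0// ?sqr_ge0 ?mulr_ge0//; lra.
Qed.

(** The right-hand side is independent of [i], which makes it an upper bound for
the maximum of the residuals over the window [n <= i <= n+j]. *)
Lemma residual_tail_le (Y : Omega -> R) n j i w :
  (forall k, dist k w <= Y w) -> (n <= i)%N -> (i <= n + j)%N ->
  residual i w <= (4 + 6 * B) / (n%:R + 2) * Y w +
    (3 * B + 1) * \sum_(k < n.+1 + j) tail_weight R n k * noise k w.
Proof.
move=> dY ni ij.
have B0 : 0 <= B := B_ge0.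
have i0 : 0 <= i%:R :> R by [].
have n0 : 0 <= n%:R :> R by [].
have in' : n%:R <= i%:R :> R by rewrite ler_nat.
have Y0 : 0 <= Y w by exact: le_trans (normr_ge0 _) (dY 0%N).
apply: le_trans (residual_le i w) _.
set I : R := i%:R in i0 in' *.
pose v := ((I + 1) * (I + 2))^-1.
have v0 : 0 <= v by rewrite invr_ge0 mulr_ge0//; lra.
pose W := \sum_(k < n.+1 + j) tail_weight R n k * noise k w.
have term0 k : 0 <= tail_weight R n k * noise k w.
  by rewrite mulr_ge0// tail_weight_ge0.
have sumW : v * \sum_(k < i.+1) noise k w <= W.
  rewrite /W -(big_mkord xpredT (fun k => tail_weight R n k * noise k w)).
  rewrite (@big_cat_nat _ _ _ i.+1)//= ?addSn ?ltnS//.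
  rewrite big_mkord; apply: ler_wpDr; first by apply: sumr_ge0.
  rewrite mulr_sumr; apply: ler_sum => k _.
  by apply: ler_wpM2r => //; apply: tail_weight_ge => //; rewrite -ltnS.
have lastW : ((I + 2) ^+ 2)^-1 * noise i w <= W.
  apply: le_trans sumW; rewrite big_ord_recr mulrDr /=.
  apply: ler_wpDl; first by rewrite mulr_ge0// sumr_ge0.
  have pos1 : 0 < (I + 1) * (I + 2) by rewrite mulr_gt0//; lra.
  have pos2 : 0 < (I + 2) ^+ 2 by rewrite exprn_gt0//; lra.
  apply: ler_wpM2r; first exact: noise_ge0.
  by rewrite /v lef_pV2 ?posrE// expr2 ler_wpM2r//; lra.
have sumY : \sum_(k < i) dist k w <= I * Y w.
  have -> : I * Y w = \sum_(k < i) Y w by rewrite sumr_const card_ord mulr_natl.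
  by apply: ler_sum.
have main : (2 + B) * (2 / (I + 2)) * Y w + B * v * ((4 + 2 * I) * Y w)
    <= (4 + 6 * B) / (n%:R + 2) * Y w.
  rewrite mulrA -mulrDl; apply: ler_wpM2r => //.
  apply: (@le_trans _ _ ((4 + 6 * B) / (I + 2))).
    rewrite -subr_ge0 (_ : _ - _ = 2 * (B * I) / ((I + 1) * (I + 2))).
      by rewrite divr_ge0 ?mulr_ge0//; lra.
    by rewrite /v; field; lra.
  apply: ler_wpM2l; first by lra.
  by rewrite lef_pV2 ?posrE; lra.
have h1 : (2 + B) * (2 / (I + 2)) * dist i w <= (2 + B) * (2 / (I + 2)) * Y w.
  by apply: ler_wpM2l => //; rewrite mulr_ge0 ?divr_ge0//; lra.
have h2 : B * v * (2 * dist 0%N w + 2 * dist 1%N w + 2 * (\sum_(k < i) dist k w))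
    <= B * v * ((4 + 2 * I) * Y w).
  apply: ler_wpM2l; first exact: mulr_ge0.
  have := dY 0%N; have := dY 1%N; lra.
have h3 : B * (v * \sum_(k < i.+1) noise k w) <= B * W by exact: ler_wpM2l.
rewrite -/W -/v mulrDr [B * v * (3 * _)]mulrCA -[B * v * _]mulrA; lra.
Qed.

(** The mean of the dominating variable of [residual_tail_le] stays bounded as the
window grows, so the probability that some residual in the window reaches [eps]
is bounded independently of [j]. *)
Lemma prob_residual_tail_le (Y : Omega -> R) n eps :
  mean_le P Y K0 -> {ae P, forall w, forall k, dist k w <= Y w} -> 0 < eps ->
  (P [set w | exists i : nat, (n <= i)%N /\ (eps <= residual i w)%R] <=
   (1 / eps * ((((4 + 6 * B) * K0 + 2 * (3 * B + 1) * K2)) / (n%:R + 2)))%:E)%E.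
Proof.
move=> mY dY eps0.
pose A j := [set w | exists i, (n <= i <= n + j)%N /\ eps <= residual i w].
have -> : [set w | exists i : nat, (n <= i)%N /\ (eps <= residual i w)%R] =
    \bigcup_j A j.
  apply/seteqP; split => [w [i [ni ri]]|w [j _ [i [/andP[ni _] ri]]]]; last by exists i.
  by exists i => //; exists i; rewrite ni leq_addl.
apply: (@mean_le_markov_bigcup _ _ _ P A (fun j w =>
    (4 + 6 * B) / (n%:R + 2) * Y w +
    (3 * B + 1) * \sum_(k < n.+1 + j) tail_weight R n k * noise k w)) => //.
- move=> j.
  have B0 : 0 <= B := B_ge0.
  have n0 : 0 <= n%:R :> R by [].
  have h : mean_le P (fun w => (4 + 6 * B) / (n%:R + 2) * Y w +
      (3 * B + 1) * \sum_(k < n.+1 + j) tail_weight R n k * noise k w)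
    ((4 + 6 * B) / (n%:R + 2) * K0 +
      (3 * B + 1) * \sum_(k < n.+1 + j) tail_weight R n k * K2).
    apply: mean_leD; apply: mean_leZ => //; try by rewrite ?divr_ge0//; lra.
    apply: (@mean_le_sum _ _ _ P (fun k w => tail_weight R n k * noise k w)
      (fun k => tail_weight R n k * K2)) => k.
    by apply: mean_leZ => //; exact: tail_weight_ge0.
  apply: mean_le_weaken h; rewrite -mulr_suml tail_weight_sum.
  have : 0 <= (3 * B + 1) * (1 / (n%:R + j%:R + 2) * K2).
    rewrite mulr_ge0 ?mulr_ge0 ?divr_ge0 ?addr_ge0//; lra.
  lra.
- move=> j.
  rewrite (_ : A j = \bigcup_(i in [set i | (n <= i <= n + j)%N])
      [set w | eps <= residual i w]); last first.
    apply/seteqP; split => [w [i [h r]]|w [i h r]]; by exists i.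
  apply: bigcup_measurable => i _.
  rewrite -[X in measurable X]setTI.
  by apply: measurable_fun_le => //; exact: measurable_residual.
- move=> j j' jj'; apply/subsetPset => w [i [/andP[ni ij] r]]; exists i.
  by rewrite ni (leq_trans ij)// leq_add2l.
apply: filterS dY => w dY j [i [/andP[ni ij] r]].
exact: le_trans r (residual_tail_le dY ni ij).
Qed.
End iteration.

Unset Implicit Arguments.

Theorem theorem4p9 (R : realType) :
  exists l l' : nat -> R -> R -> R,
    (forall K0 K2 B, 0 <= l K0 K2 B) /\
    (forall K0 K2 B, 0 <= l' K0 K2 B) /\
    forall (d : measure_display) (Omega : measurableType d)
      (P : probability Omega R) (X : normedModType R) (U : X -> X)
      (x0 u : {RV P >-> borel X}) (delta : nat -> {RV P >-> borel X})
      (beta : R) (x y : nat -> Omega -> X) (K0 : nat) (K2 B : R),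
    separable X ->
    nonexpansive U ->
    0 < beta < 1 ->
    halpern_mann U x0 u (fun n => delta n : Omega -> X)
      (fun n => 2 / (n%:R + 2)) (fun _ => beta) x y ->
    (0 < K0)%N ->
    (forall n : nat,
      [/\ ('E_P[fun w => (`|x n w - (u w : X)|)%R] <= (K0%:R)%:E)%E,
          ('E_P[fun w => (`|U (y n w) - y n w|)%R] <= (K0%:R)%:E)%E,
          ('E_P[fun w => (`|U (u w : X) - (u w : X)|)%R] <= (K0%:R)%:E)%E
        & ('E_P[fun w => (`|U (y n w) - (u w : X)|)%R] <= (K0%:R)%:E)%E]) ->
    0 <= K2 ->
    (forall n : nat,
      ('E_P[fun w => (`|(delta n w : X)|)%R] <= (K2 / (n%:R + 2) ^+ 2)%:E)%E) ->
    1 / (1 - beta) <= B ->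
    (forall n : nat, (0 < n)%N ->
      ('E_P[fun w => (`|U (x n w) - x n w|)%R]
         <= (2 * l K0 K2 B / (n%:R + 2))%:E)%E) /\
    (forall Y : {RV P >-> R},
      (forall w, 0 <= Y w) ->
      ('E_P[Y] <= (K0%:R)%:E)%E ->
      (forall n : nat,
        {ae P, forall w,
          [/\ `|x n w - (u w : X)| <= Y w,
              `|U (y n w) - y n w| <= Y w,
              `|U (u w : X) - (u w : X)| <= Y w
            & `|U (y n w) - (u w : X)| <= Y w]}) ->
      forall (n : nat) (eps : R), (0 < n)%N -> 0 < eps ->
        (P [set w | exists i : nat,
              (n <= i)%N /\ (eps <= `|U (x i w) - x i w|)%R]
          <= (1 / eps * (4 * l' K0 K2 B / (n%:R + 2)))%:E)%E).
Proof.
(* The absolute values only ensure nonnegativity on all triples; under the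
   hypotheses on K2 and B their arguments are nonnegative. *)
exists (fun K0 K2 B => `|4 * K0%:R + B * (6 * K0%:R + 3 * K2) + K2| / 2).
exists (fun K0 K2 B => `|(4 + 6 * B) * K0%:R + 2 * (3 * B + 1) * K2| / 4).
split; first by move=> *; rewrite divr_ge0.
split; first by move=> *; rewrite divr_ge0.
move=> d Omega P X U x0 u delta beta x y K0 K2 B sepX neU beta01 hm _ meanK.
move=> K2_ge0 mean_delta B_ge.
have K0_ge0 : 0 <= K0%:R :> R by [].
have hdist k : ('E_P[fun w => (`|x k w - (u w : X)|)%R] <= (K0%:R)%:E)%E.
  by have [] := meanK k.
split=> [n _|Y Y_ge0 meanY distY n eps _ eps_gt0].
  have rate := mean_residual_le sepX neU beta01 hm K2_ge0 B_ge K0_ge0 mean_delta.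
  apply: le_trans (rate n hdist) _.
  rewrite lee_fin mulrCA mulfV// mulr1; apply: ler_wpM2r; last exact: ler_norm.
  by rewrite invr_ge0 addr_ge0.
have mY : mean_le P Y K0%:R by split => //; exact: measurable_funPT.
have distY' : {ae P, forall w, forall k, `|x k w - (u w : X)| <= Y w}.
  apply: ae_foralln => k; apply: filterS (distY k).
  by move=> w [].
have rate := prob_residual_tail_le sepX neU beta01 hm K2_ge0 B_ge mean_delta.
apply: le_trans (rate K0%:R Y n eps mY distY' eps_gt0) _.
rewrite lee_fin; apply: ler_wpM2l; first by rewrite divr_ge0// ltW.
rewrite mulrCA mulfV// mulr1; apply: ler_wpM2r; last exact: ler_norm.
by rewrite invr_ge0 addr_ge0.
Qed.
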